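(* Let $p$ be a prime number. There is an equality $$\underline{\mathrm{Hom}}_{\mathbb{Z}}^{\mathrm{KM+D}}((\mathbb{Z}/p\mathbb{Z})^2,\mu_p \times \mu_p) = \underline{\mathrm{Hom}}_{\mathbb{Z}}^{\mathrm{full}}((\mathbb{Z}/p\mathbb{Z})^2,\mu_p \times \mu_p)$$ of closed subschemes of $\underline{\mathrm{Hom}}_{\mathbb{Z}}((\mathbb{Z}/p\mathbb{Z})^2,\mu_p \times \mu_p)$.
   Context: $p$ is a prime, $\Phi_p(X)=1+X+\dots+X^{p-1}$, and $\mu_p$ is the group scheme of $p$-th roots of unity over $\mathbb{Z}$. The scheme $\underline{\mathrm{Hom}}_{\mathbb{Z}}((\mathbb{Z}/p\mathbb{Z})^2,\mu_p\times\mu_p)$ of group scheme homomorphisms is $\mathrm{Spec}(\mathcal{A})$ with $$\mathcal{A}=\mathbb{Z}[S,T,U,V]/(S^p-1,T^p-1,U^p-1,V^p-1),$$ the universal homomorphism being $h=\begin{pmatrix} S & T \\ U & V \end{pmatrix}$, i.e. $(1,0)\mapsto (S,U)$, $(0,1)\mapsto (T,V)$. Full homomorphisms: an element $(x,y)$ of $\mu_p\times\mu_p$ is primitive if $\Phi_p(x)\Phi_p(y)=0$; a pair of elements of $\mu_p\times\mu_p$ is linearly independent if every non-trivial $\mathbb{F}_p$-linear combination (written multiplicatively) is primitive. $\underline{\mathrm{Hom}}^{\mathrm{full}}_{\mathbb{Z}}((\mathbb{Z}/p\mathbb{Z})^2,\mu_p\times\mu_p)$ is the closed subscheme cut out by the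 conditions that the rows of $h$ are linearly independent and the columns of $h$ are linearly independent. Explicitly it is $\mathrm{Spec}(\mathcal{A}/\mathcal{I})$, where $\mathcal{I}$ is generated by $\Phi_p(S^aU^b)\Phi_p(T^aV^b)$ and $\Phi_p(S^aT^b)\Phi_p(U^aV^b)$ for all $(a,b)\in\mathbb{F}_p^2\setminus\{(0,0)\}$. $\times$-homomorphisms (Katz–Mazur): let $S$ be a scheme and $Z,Z'$ finite flat $S$-schemes of finite presentation, both of rank $N$. A morphism $\phi:Z'\to Z$ over $S$ is a $\times$-homomorphism if for every $\mathrm{Spec}(R)\to S$ and every $f\in H^0(\mathcal{O}_{Z_R})$ (where $Z_R=Z\times_S\mathrm{Spec}(R)$) one has $\det(T-f)=\det(T-\phi^*(f))$ in $R[T]$, where $f$ and $\phi^*(f)$ are viewed as the multiplication endomorphisms of the locally free rank-$N$ $R$-modules $H^0(\mathcal{O}_{Z_R})$ and $H^0(\mathcal{O}_{Z'_R})$. For finite flat group schemes $G,H$ over $S$ (of the same rank), $\underline{\mathrm{Hom}}^\times_S(G,H)$ is the closed subscheme of $\underline{\mathrm{Hom}}_S(G,H)$ (the scheme of group scheme homomorphisms) parametrizing those homomorphisms that are $\times$-homomorphisms. KM+D: with $(-)^\vee$ the Cartier dual, $\phi\mapsto\phi^\vee$ gives an isomorphism $\underline{\mathrm{Hom}}_S(G,H)\simeq\underline{\mathrm{Hom}}_S(H^\vee,G^\vee)$, through which $\underline{\mathrm{Hom}}^\times_S(H^\vee,G^\vee)$ is viewed as a closed subscheme of $\underline{\mathrm{Hom}}_S(G,H)$.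 Define $$\underline{\mathrm{Hom}}^{\mathrm{KM+D}}_S(G,H)=\underline{\mathrm{Hom}}_S^\times(G,H)\cap\underline{\mathrm{Hom}}^\times_S(H^\vee,G^\vee)$$ (scheme-theoretic intersection), i.e. both $\phi$ and its Cartier dual $\phi^\vee$ are required to be $\times$-homomorphisms. *)

(* Defs.v *)
(* Finite free commutative group schemes over an
   affine base are given by the structure constants of their Hopf algebra in a
   basis; closed subschemes of Spec(A) are given by ideals of A, and the
   subfunctor cut out by an ideal is read off on ring morphisms A -> R. *)
From HB Require Import structures.
From mathcomp Require Import all_boot all_order all_algebra.
From mathcomp Require Import mpoly.
From mathcomp Require Import boolp.

Set Implicit Arguments.
Unset Strict Implicit.
Unset Printing Implicit Defensive.

Import GRing.Theory.
Local Open Scope ring_scope.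
Local Open Scope quotient_scope.

Definition is_ideal (A : comNzRingType) (J : A -> Prop) : Prop :=
  [/\ J 0, forall x y, J x -> J y -> J (x + y) & forall a x, J x -> J (a * x)].

Definition gen_ideal (A : comNzRingType) (X : A -> Prop) : A -> Prop :=
  fun x => forall J : A -> Prop, is_ideal J -> (forall y, X y -> J y) -> J x.

(* The ideal of the scheme-theoretic intersection of V(J) and V(K). *)
Definition sum_ideal (A : comNzRingType) (J K : A -> Prop) : A -> Prop :=
  fun x => exists y z, [/\ J y, K z & x = y + z].

Definition same_ideal (A : comNzRingType) (J K : A -> Prop) : Prop :=
  forall x, J x <-> K x.

Lemma gen_ideal_is_ideal (A : comNzRingType) (X : A -> Prop) :
  is_ideal (gen_ideal X).
Proof.
split=> [J [] //|x y hx hy J hJ XJ|a x hx J hJ XJ].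
  by case: (hJ) => _ hD _; apply: hD; [apply: hx|apply: hy].
by case: (hJ) => _ _; apply; apply: hx.
Qed.

Lemma gen_ideal_sub (A : comNzRingType) (X : A -> Prop) (x : A) :
  X x -> gen_ideal X x.
Proof. by move=> hx J _; apply. Qed.

Lemma ker_is_ideal (A B : comNzRingType) (f : {rmorphism A -> B}) :
  is_ideal (fun x => f x = 0).
Proof.
split=> [|x y hx hy|a x hx]; rewrite ?rmorph0 // ?rmorphD ?rmorphM.
  by rewrite hx hy addr0.
by rewrite hx mulr0.
Qed.

(* A group scheme G over Spec(R) whose Hopf algebra O(G) is a free R-module
   with basis (b_i) indexed by I:
     b_i b_j  = \sum_k mulc i j k b_k,           1     = \sum_i onec i b_i,
     Delta(b_k) = \sum_(i, j) comulc i j k (b_i (x) b_j),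
     epsilon(b_i) = counitc i.
   The antipode is determined by these data and preserved by all morphisms of
   bialgebras, so it is not recorded. *)
Record gscheme (R : comNzRingType) (I : finType) := GScheme {
  mulc : I -> I -> I -> R;
  onec : I -> R;
  comulc : I -> I -> I -> R;
  counitc : I -> R }.

Definition base_change (R R' : comNzRingType) (I : finType)
    (g : {rmorphism R -> R'}) (G : gscheme R I) : gscheme R' I :=
  GScheme (fun i j k => g (mulc G i j k)) (fun i => g (onec G i))
          (fun i j k => g (comulc G i j k)) (fun i => g (counitc G i)).

Definition prod_gscheme (R : comNzRingType) (I J : finType)
    (G : gscheme R I) (H : gscheme R J) : gscheme R (I * J)%type :=
  GScheme (fun i j k => mulc G i.1 j.1 k.1 * mulc H i.2 j.2 k.2)
          (fun i => onec G i.1 * onec H i.2)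
          (fun i j k => comulc G i.1 j.1 k.1 * comulc H i.2 j.2 k.2)
          (fun i => counitc G i.1 * counitc H i.2).

(* O(G^\vee) = Hom_R(O(G), R), in the basis dual to that of O(G). *)
Definition cartier_dual (R : comNzRingType) (I : finType)
    (G : gscheme R I) : gscheme R I :=
  GScheme (comulc G) (counitc G) (mulc G) (onec G).

(* A morphism phi : G -> H is given by the matrix M of phi^* : O(H) -> O(G),
   phi^*(c_j) = \sum_i M j i b_i. *)
Definition is_ghom (R : comNzRingType) (I J : finType)
    (G : gscheme R I) (H : gscheme R J) (M : J -> I -> R) : Prop :=
  [/\ forall j j' i, \sum_k mulc H j j' k * M k i =
        \sum_i1 \sum_i2 M j i1 * M j' i2 * mulc G i1 i2 i,
      forall i, \sum_j onec H j * M j i = onec G i,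
      forall j i1 i2, \sum_i M j i * comulc G i1 i2 i =
        \sum_j1 \sum_j2 comulc H j1 j2 j * (M j1 i1 * M j2 i2)
    & forall j, \sum_i M j i * counitc G i = counitc H j].

Definition base_change_hom (R R' : comNzRingType) (I J : finType)
    (g : {rmorphism R -> R'}) (M : J -> I -> R) : J -> I -> R' :=
  fun j i => g (M j i).

(* phi^\vee : H^\vee -> G^\vee corresponds to the transpose of phi^*. *)
Definition dual_hom (R : comNzRingType) (I J : finType) (M : J -> I -> R) :
  I -> J -> R := fun i j => M j i.

(* The element \sum_j f j c_j of O(H) is pulled back to O(G). *)
Definition pullback (R : comNzRingType) (I J : finType) (M : J -> I -> R)
    (f : J -> R) : I -> R := fun i => \sum_j f j * M j i.

(* Multiplication by f = \sum_i f i b_i on O(G): the row of index i holds the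
   coordinates of f b_i. *)
Definition mult_mx (R : comNzRingType) (I : finType) (G : gscheme R I)
    (f : I -> R) : 'M[R]_#|I| :=
  \matrix_(k, l) \sum_i f i * mulc G i (enum_val k) (enum_val l).

(* The spectrum of the zero ring, which comNzRingType excludes, imposes no
   condition.  The ranks #|I| and #|J| agree as soon as the condition holds,
   since they are the degrees of the two polynomials. *)
Definition times_hom (R : comNzRingType) (I J : finType)
    (G : gscheme R I) (H : gscheme R J) (M : J -> I -> R) : Prop :=
  forall (R' : comNzRingType) (g : {rmorphism R -> R'}) (f : J -> R'),
    char_poly (mult_mx (base_change g H) f) =
    char_poly (mult_mx (base_change g G) (pullback (base_change_hom g M) f)).

(* Let M be a morphism G -> H over Spec(A).  The closed subscheme of Spec(A)
   parametrizing the points where M becomes a times-homomorphism is the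
   smallest one through which all these points factor; times_idealP checks
   that it has no other points. *)
Definition times_ideal (A : comNzRingType) (I J : finType)
    (G : gscheme A I) (H : gscheme A J) (M : J -> I -> A) : A -> Prop :=
  fun a => forall (R : comNzRingType) (f : {rmorphism A -> R}),
    times_hom (base_change f G) (base_change f H) (base_change_hom f M) ->
    f a = 0.

Lemma times_idealP (A : comNzRingType) (I J : finType)
    (G : gscheme A I) (H : gscheme A J) (M : J -> I -> A)
    (R : comNzRingType) (f : {rmorphism A -> R}) :
  times_hom (base_change f G) (base_change f H) (base_change_hom f M) <->
  (forall a, times_ideal G H M a -> f a = 0).
Proof.
split=> [hf a ha|kill]; first exact: ha.
pose N := #|J|; pose K := {mpoly A[N]}.
pose c : {rmorphism A -> K} := @mpolyC N A.
pose e (B : comNzRingType) (j : J) : {mpoly B[N]} := 'X_(enum_rank j).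
pose P := char_poly (mult_mx (base_change c H) (e A)).
pose Q := char_poly (mult_mx (base_change c G)
                       (pullback (base_change_hom c M) (e A))).
have specP (B B' : comNzRingType) (f1 : {rmorphism A -> B})
    (g : {rmorphism B -> B'}) (v : J -> B') (th : {rmorphism K -> B'}) :
    (forall a, th (c a) = g (f1 a)) -> (forall j, th (e A j) = v j) ->
    map_poly th P = char_poly (mult_mx (base_change g (base_change f1 H)) v)
    /\ map_poly th Q =
       char_poly (mult_mx (base_change g (base_change f1 G))
         (pullback (base_change_hom g (base_change_hom f1 M)) v)).
  move=> thc the; split; rewrite map_char_poly; congr char_poly.
    apply/matrixP=> k l; rewrite !mxE rmorph_sum; apply: eq_bigr => j _.
    by rewrite rmorphM /= the thc.
  apply/matrixP=> k l; rewrite !mxE rmorph_sum; apply: eq_bigr => i _.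
  rewrite rmorphM /= thc rmorph_sum; congr (_ * _); apply: eq_bigr => j _.
  by rewrite rmorphM /= the thc.
have coefJ n m : times_ideal G H M (P - Q)`_n@_m.
  move=> B f1 hf1.
  pose th : {rmorphism K -> {mpoly B[N]}} := map_mpoly f1.
  pose d : {rmorphism B -> {mpoly B[N]}} := @mpolyC N B.
  have thc a : th (c a) = d (f1 a) by rewrite /= map_mpolyC.
  have the j : th (e A j) = e B j by rewrite /= map_mpolyX.
  have [eP eQ] := specP B _ f1 d (e B) th thc the.
  have := hf1 _ d (e B); rewrite -eP -eQ => ePQ.
  rewrite -mcoeff_map_mpoly.
  rewrite -[map_mpoly f1 _]/(th _) -coef_map rmorphB /= ePQ subrr coef0.
  by rewrite mcoeff0.
move=> R' g v.
pose th : {rmorphism K -> R'} := mmap (g \o f) (fun k => v (enum_val k)).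
have thc a : th (c a) = g (f a) by rewrite /= mmapC.
have the j : th (e A j) = v j by rewrite /= mmapX mmap1U enum_rankK.
have [<- <-] := specP R R' f g v th thc the.
apply/eqP; rewrite -subr_eq0 -rmorphB; apply/eqP/polyP=> n.
rewrite coef_map coef0 /= /mmap big1 // => m _ /=.
by rewrite (kill _ (coefJ n m)) rmorph0 mul0r.
Qed.

(* O = functions on A, with basis the indicator functions. *)
Definition const_gscheme (A : finZmodType) : gscheme int A :=
  GScheme (fun i j k => ((i == j) && (j == k))%:R) (fun _ => 1)
          (fun i j k => (i + j == k)%:R) (fun i => (i == 0)%:R).

(* O = Z[x]/(x^p - 1), with basis 1, x, ..., x^(p-1) and x group-like. *)
Definition mu (p : nat) : gscheme int 'I_p :=
  GScheme (fun i j k : 'I_p => ((i + j)%N == k %[mod p])%N%:R)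
          (fun i => ((i : nat) == 0%N)%:R)
          (fun i j k => ((i == k) && (j == k))%:R) (fun _ => 1).

(* 'Z_p is Z/pZ only for p > 1, as is the case when p is prime. *)
Definition ZpZp (p : nat) : gscheme int ('Z_p * 'Z_p)%type :=
  prod_gscheme (const_gscheme 'Z_p) (const_gscheme 'Z_p).

Definition mumu (p : nat) : gscheme int ('I_p * 'I_p)%type :=
  prod_gscheme (mu p) (mu p).

Definition over (R : comNzRingType) (I : finType) (G : gscheme int I) :
  gscheme R I := base_change (intmul (1 : R)) G.

(* The ring Z[S,T,U,V]/(S^p-1, T^p-1, U^p-1, V^p-1). *)
Definition hom_rel (p : nat) : {pred {mpoly int[4]}} :=
  fun q => `[< gen_ideal (fun r => exists i : 'I_4, r = 'X_i ^+ p - 1) q >].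

Lemma hom_rel_idealr (p : nat) : idealr_closed (hom_rel p).
Proof.
have [J0 JD JM] := gen_ideal_is_ideal
  (fun r : {mpoly int[4]} => exists i : 'I_4, r = 'X_i ^+ p - 1).
split; first exact/asboolP.
  apply/negP => /asboolP h1.
  pose ev : {rmorphism {mpoly int[4]} -> int} := meval (fun _ => 1).
  suff /eqP : ev 1 = 0 by rewrite rmorph1 oner_eq0.
  apply: (h1 (fun x => ev x = 0)) => [|_ [i ->]]; first exact: ker_is_ideal.
  by rewrite rmorphB rmorphXn rmorph1 /= mevalXU expr1n subrr.
move=> a u v /asboolP hu /asboolP hv; apply/asboolP.
exact: (JD _ _ (JM a u hu) hv).
Qed.

HB.instance Definition _ (p : nat) :=
  isIdealr.Build _ (hom_rel p) (hom_rel_idealr p).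

Definition hom_ring (p : nat) : comNzRingType := {ideal_quot (hom_rel p)}.

Definition hom_var (p : nat) (k : nat) : hom_ring p :=
  \pi_({ideal_quot (hom_rel p)}) ('X_(inord k : 'I_4)).
Definition varS (p : nat) : hom_ring p := hom_var p 0.
Definition varT (p : nat) : hom_ring p := hom_var p 1.
Definition varU (p : nat) : hom_ring p := hom_var p 2.
Definition varV (p : nat) : hom_ring p := hom_var p 3.

(* h sends (1, 0) to (S, U) and (0, 1) to (T, V), so that the coordinates of
   h(a, b) are S^a T^b and U^a V^b, and h^*(x^i y^j) takes at (a, b) the value
   (S^a T^b)^i (U^a V^b)^j. *)
Definition univ_hom (p : nat) :
    'I_p * 'I_p -> 'Z_p * 'Z_p -> hom_ring p :=
  fun j i => (varS p ^+ i.1 * varT p ^+ i.2) ^+ j.1 *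
             (varU p ^+ i.1 * varV p ^+ i.2) ^+ j.2.
Arguments univ_hom : clear implicits.

Lemma sum_delta (R : comNzRingType) (I : finType) (i0 : I) (F : I -> R) :
  \sum_i (i == i0)%:R * F i = F i0.
Proof.
rewrite (bigD1 i0) //= eqxx mul1r big1 ?addr0 // => i /negPf ->.
by rewrite mul0r.
Qed.

Lemma sum_delta2 (R : comNzRingType) (I : finType) (i0 : I)
    (F : I -> I -> R) :
  \sum_i \sum_j ((i == i0) && (j == i0))%:R * F i j = F i0 i0.
Proof.
rewrite -(sum_delta i0 (fun i => F i i0)); apply: eq_bigr => i _.
rewrite -(sum_delta i0 (F i)) mulr_sumr; apply: eq_bigr => j _.
by rewrite mulrA -natrM mulnb.
Qed.

Section Entries.
Variables (p : nat) (R : comNzRingType).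
Local Notation G := (over R (ZpZp p)).
Local Notation H := (over R (mumu p)).

Lemma ZpZp_mulc i j k : mulc G i j k = ((i == k) && (j == k))%:R.
Proof.
case: i j k => [i i'] [j j'] [k k'] /=.
rewrite rmorphM /= !rmorph_nat -natrM mulnb !xpair_eqE; congr (nat_of_bool _)%:R.
by case: (j =P k) => [->|_]; case: (j' =P k') => [->|_];
  rewrite ?(andbT, andbF).
Qed.

Lemma ZpZp_onec i : onec G i = 1.
Proof. by rewrite /= mulr1. Qed.

Lemma ZpZp_comulc i j k :
  comulc G i j k = (k == (i.1 + j.1, i.2 + j.2))%:R.
Proof.
case: i j k => [i i'] [j j'] [k k'] /=.
rewrite rmorphM /= !rmorph_nat -natrM mulnb !xpair_eqE; congr (nat_of_bool _)%:R.
by rewrite (eq_sym k) (eq_sym k').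
Qed.

Lemma ZpZp_counitc i : counitc G i = (i == (0, 0))%:R.
Proof.
case: i => [i i'] /=.
by rewrite rmorphM /= !rmorph_nat -natrM mulnb xpair_eqE.
Qed.

Hypothesis p_gt0 : (0 < p)%N.

Definition ord_mod (n : nat) : 'I_p := Ordinal (ltn_pmod n p_gt0).

Lemma mumu_mulc i j k :
  mulc H i j k = (k == (ord_mod (i.1 + j.1), ord_mod (i.2 + j.2)))%:R.
Proof.
case: i j k => [i i'] [j j'] [k k'] /=.
rewrite rmorphM /= !rmorph_nat -natrM mulnb !xpair_eqE; congr (nat_of_bool _)%:R.
by rewrite -!val_eqE /= !(modn_small (ltn_ord _)) (eq_sym (val k)) (eq_sym (val k')).
Qed.

Lemma mumu_onec i : onec H i = (i == (ord_mod 0, ord_mod 0))%:R.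
Proof.
case: i => [i i'] /=.
rewrite rmorphM /= !rmorph_nat -natrM mulnb xpair_eqE.
by rewrite -!val_eqE /= !mod0n.
Qed.

Lemma mumu_comulc i j k : comulc H i j k = ((i == k) && (j == k))%:R.
Proof.
case: i j k => [i i'] [j j'] [k k'] /=.
rewrite rmorphM /= !rmorph_nat -natrM mulnb !xpair_eqE; congr (nat_of_bool _)%:R.
by case: (i == k) (i' == k') (j == k) (j' == k') => [] [] [] [].
Qed.

Lemma mumu_counitc i : counitc H i = 1.
Proof. by rewrite /= mulr1. Qed.

Lemma ghom_eqns (M : 'I_p * 'I_p -> 'Z_p * 'Z_p -> R) :
  is_ghom G H M <->
  [/\ forall (j j' : 'I_p * 'I_p) i,
        M (ord_mod (j.1 + j'.1), ord_mod (j.2 + j'.2)) i = M j i * M j' i,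
      forall i, M (ord_mod 0, ord_mod 0) i = 1,
      forall j i i', M j (i.1 + i'.1, i.2 + i'.2) = M j i * M j i'
    & forall j, M j (0, 0) = 1].
Proof.
have E1 (j j' : 'I_p * 'I_p) i : \sum_k mulc H j j' k * M k i =
    M (ord_mod (j.1 + j'.1), ord_mod (j.2 + j'.2)) i.
  rewrite -(sum_delta _ (fun k => M k i)).
  by apply: eq_bigr => k _; rewrite mumu_mulc.
have E2 j j' i : \sum_i1 \sum_i2 M j i1 * M j' i2 * mulc G i1 i2 i =
    M j i * M j' i.
  rewrite -(sum_delta2 i (fun i1 i2 => M j i1 * M j' i2)).
  by apply: eq_bigr => i1 _; apply: eq_bigr => i2 _; rewrite ZpZp_mulc mulrC.
have E3 i : \sum_j onec H j * M j i = M (ord_mod 0, ord_mod 0) i.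
  rewrite -(sum_delta _ (fun k => M k i)).
  by apply: eq_bigr => k _; rewrite mumu_onec.
have E4 j i i' : \sum_k M j k * comulc G i i' k =
    M j (i.1 + i'.1, i.2 + i'.2).
  rewrite -(sum_delta _ (M j)).
  by apply: eq_bigr => k _; rewrite ZpZp_comulc mulrC.
have E5 j i i' : \sum_j1 \sum_j2 comulc H j1 j2 j * (M j1 i * M j2 i') =
    M j i * M j i'.
  rewrite -(sum_delta2 j (fun j1 j2 => M j1 i * M j2 i')).
  by apply: eq_bigr => j1 _; apply: eq_bigr => j2 _; rewrite mumu_comulc.
have E6 j : \sum_i M j i * counitc G i = M j (0, 0).
  rewrite -(sum_delta _ (M j)).
  by apply: eq_bigr => k _; rewrite ZpZp_counitc mulrC.
split=> -[h1 h2 h3 h4]; split=> *.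
- by rewrite -E1 h1 E2.
- by rewrite -E3 h2 ZpZp_onec.
- by rewrite -E4 h3 E5.
- by rewrite -E6 h4 mumu_counitc.
- by rewrite E1 h1 E2.
- by rewrite E3 h2 ZpZp_onec.
- by rewrite E4 h3 E5.
- by rewrite E6 h4 mumu_counitc.
Qed.
End Entries.

Lemma hom_varXp (p k : nat) : hom_var p k ^+ p = 1.
Proof.
rewrite /hom_var -[RHS](rmorph1 (\pi_({ideal_quot (hom_rel p)}))) -rmorphXn.
apply/eqP; rewrite -Quotient.idealrBE; apply/asboolP; apply: gen_ideal_sub.
by exists (inord k).
Qed.

Lemma hom_ring_lift (p : nat) (R : comNzRingType) (v : 'I_4 -> R) :
  (forall i, v i ^+ p = 1) ->
  exists f : {rmorphism hom_ring p -> R}, forall k, f (hom_var p k) = v (inord k).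
Proof.
move=> vp.
pose ev : {rmorphism {mpoly int[4]} -> R} := mmap (intmul (1 : R)) v.
pose f (x : hom_ring p) : R := ev (repr (x : {ideal_quot (hom_rel p)})).
have fpi q : f (\pi_({ideal_quot (hom_rel p)}) q) = ev q.
  apply/eqP; rewrite /f -subr_eq0 -rmorphB; apply/eqP.
  have /eqP : repr (\pi_({ideal_quot (hom_rel p)}) q) =
         q %[mod {ideal_quot (hom_rel p)}] by rewrite reprK.
  rewrite -Quotient.idealrBE => /asboolP h.
  apply: (h (fun x => ev x = 0)) => [|_ [i ->]]; first exact: ker_is_ideal.
  by rewrite rmorphB rmorphXn rmorph1 /= mmapX mmap1U vp subrr.
have fB : zmod_morphism f.
  move=> x y; rewrite -[x](@reprK _ {ideal_quot (hom_rel p)}).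
  rewrite -[y](@reprK _ {ideal_quot (hom_rel p)}).
  by rewrite -[X in f X]rmorphB !fpi rmorphB.
have fM : monoid_morphism f.
  split; first by rewrite -[1](rmorph1 (\pi_({ideal_quot (hom_rel p)}))) fpi rmorph1.
  move=> x y; rewrite -[x](@reprK _ {ideal_quot (hom_rel p)}).
  rewrite -[y](@reprK _ {ideal_quot (hom_rel p)}).
  by rewrite -[X in f X]rmorphM !fpi rmorphM.
pose fZ := GRing.isZmodMorphism.Build _ _ f fB.
pose fMM := GRing.isMonoidMorphism.Build _ _ f fM.
pose F : {rmorphism hom_ring p -> R} := HB.pack f fZ fMM.
by exists F => k; rewrite /= /hom_var fpi /ev /= mmapX mmap1U.
Qed.

(* The points of Spec(hom_ring p) with values in R are the homomorphisms from
   (Z/pZ)^2 to mu_p x mu_p over R, the universal one being univ_hom p. *)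
Lemma univ_homP (p : nat) (hp : prime p) (R : comNzRingType)
    (M : 'I_p * 'I_p -> 'Z_p * 'Z_p -> R) :
  is_ghom (over R (ZpZp p)) (over R (mumu p)) M <->
  exists f : {rmorphism hom_ring p -> R},
    forall j i, M j i = base_change_hom f (univ_hom p) j i.
Proof.
have p_gt0 := prime_gt0 hp; have p_gt1 := prime_gt1 hp.
have Zpe := Zp_cast p_gt1.
have expM (x : R) (n : nat) : x ^+ p = 1 -> x ^+ (n %% p) = x ^+ n.
  by move=> xp; rewrite {2}(divn_eq n p) exprD mulnC exprM xp expr1n mul1r.
apply: (iff_trans (ghom_eqns p_gt0 M)); split.
  case=> h1 h2 h3 h4.
  pose o0 := ord_mod p_gt0 0; pose o1 := ord_mod p_gt0 1.
  pose v (k : 'I_4) : R :=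
    nth 0 [:: M (o1, o0) (1, 0); M (o1, o0) (0, 1);
              M (o0, o1) (1, 0); M (o0, o1) (0, 1)] k.
  have M1 i (n : nat) : M (ord_mod p_gt0 n, o0) i = M (o1, o0) i ^+ n.
    elim: n => [|n IHn]; first by rewrite expr0 h2.
    rewrite exprS -IHn -h1 /=; congr (M (_, _) _); apply: val_inj => /=.
      by rewrite modnDm.
    by rewrite !mod0n.
  have M2 i (n : nat) : M (o0, ord_mod p_gt0 n) i = M (o0, o1) i ^+ n.
    elim: n => [|n IHn]; first by rewrite expr0 h2.
    rewrite exprS -IHn -h1 /=; congr (M (_, _) _); apply: val_inj => /=.
      by rewrite !mod0n.
    by rewrite modnDm.
  have Mp1 i : M (o1, o0) i ^+ p = 1.
    rewrite -M1 -(h2 i); congr (M (_, _) _); apply: val_inj => /=.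
    by rewrite modnn mod0n.
  have Mp2 i : M (o0, o1) i ^+ p = 1.
    rewrite -M2 -(h2 i); congr (M (_, _) _); apply: val_inj => /=.
    by rewrite modnn mod0n.
  have Mi1 j (n : nat) : M j (n%:R, 0) = M j (1, 0) ^+ n.
    elim: n => [|n IHn]; first by rewrite expr0 h4.
    by rewrite exprS -IHn -h3 /= addr0 mulrS.
  have Mi2 j (n : nat) : M j (0, n%:R) = M j (0, 1) ^+ n.
    elim: n => [|n IHn]; first by rewrite expr0 h4.
    by rewrite exprS -IHn -h3 /= addr0 mulrS.
  have Mi j i : M j i = M j (1, 0) ^+ i.1 * M j (0, 1) ^+ i.2.
    case: i => a b /=; rewrite -Mi1 -Mi2 -h3 /= addr0 add0r.
    by congr (M _ (_, _)); rewrite natr_Zp.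
  have Mj j i : M j i = M (o1, o0) i ^+ j.1 * M (o0, o1) i ^+ j.2.
    case: j => a b /=; rewrite -M1 -M2 -h1 /=.
    congr (M (_, _) _); apply: val_inj => /=.
      by rewrite mod0n addn0 modn_mod modn_small.
    by rewrite mod0n add0n modn_mod modn_small.
  have vp k : v k ^+ p = 1.
    by case: k => [[|[|[|[|k]]]] hk] //; rewrite /v /=.
  have [f fE] := hom_ring_lift vp; exists f => j i.
  rewrite /base_change_hom /univ_hom !(rmorphM, rmorphXn) /= !fE /v.
  by rewrite !inordK //= Mj -!Mi.
case=> f fE.
have fp k : f (hom_var p k) ^+ p = 1.
  by rewrite -rmorphXn hom_varXp rmorph1.
pose x (i : 'Z_p * 'Z_p) := f (varS p ^+ i.1 * varT p ^+ i.2).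
pose y (i : 'Z_p * 'Z_p) := f (varU p ^+ i.1 * varV p ^+ i.2).
have ME j i : M j i = x i ^+ j.1 * y i ^+ j.2.
  by rewrite fE /base_change_hom /univ_hom rmorphM !rmorphXn.
have xp i : x i ^+ p = 1.
  by rewrite /x rmorphM !rmorphXn /= exprMn -!exprM ![(_ * p)%N]mulnC !exprM !fp
     !expr1n mulr1.
have yp i : y i ^+ p = 1.
  by rewrite /y rmorphM !rmorphXn /= exprMn -!exprM ![(_ * p)%N]mulnC !exprM !fp
     !expr1n mulr1.
have zD (z : R) (a b : 'Z_p) : z ^+ p = 1 -> z ^+ (a + b)%R = z ^+ a * z ^+ b.
  move=> zp; have -> : nat_of_ord (a + b)%R = ((a + b) %% p)%N.
    by rewrite /= [X in (_ %% X)%N = _]Zpe.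
  by rewrite expM // exprD.
have xD i i' : x (i.1 + i'.1, i.2 + i'.2) = x i * x i'.
  rewrite /x !rmorphM !rmorphXn.
  by rewrite !zD ?fp // mulrACA.
have yD i i' : y (i.1 + i'.1, i.2 + i'.2) = y i * y i'.
  rewrite /y !rmorphM !rmorphXn.
  by rewrite !zD ?fp // mulrACA.
split=> *; rewrite !ME /=.
- by rewrite !expM // !exprD mulrACA.
- by rewrite !mod0n !expr0 mulr1.
- by rewrite xD yD !exprMn mulrACA.
- by rewrite /x /y /= !expr0 !mulr1 rmorph1 !expr1n mulr1.
Qed.

Lemma univ_hom_inj (p : nat) (hp : prime p) (R : comNzRingType)
    (f f' : {rmorphism hom_ring p -> R}) :
  (forall j i, base_change_hom f (univ_hom p) j i =
               base_change_hom f' (univ_hom p) j i) -> f =1 f'.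
Proof.
move=> ff'.
have p_gt0 := prime_gt0 hp; have p_gt1 := prime_gt1 hp.
pose o0 : 'I_p := Ordinal p_gt0; pose o1 : 'I_p := Ordinal p_gt1.
have fv (k : 'I_4) : f (hom_var p k) = f' (hom_var p k).
  case: k => [[|[|[|[|k]]]] hk] //=.
  - have := ff' (o1, o0) (1, 0).
    by rewrite /base_change_hom /univ_hom /= !expr1 !expr0 !mulr1.
  - have := ff' (o1, o0) (0, 1).
    by rewrite /base_change_hom /univ_hom /= !expr1 !expr0 !mulr1 !mul1r.
  - have := ff' (o0, o1) (1, 0).
    by rewrite /base_change_hom /univ_hom /= !expr1 !expr0 !mulr1 !mul1r.
  - have := ff' (o0, o1) (0, 1).
    by rewrite /base_change_hom /univ_hom /= !expr1 !expr0 !mul1r.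
move=> x; rewrite -[x](@reprK _ {ideal_quot (hom_rel p)}).
elim/mpolyind: (repr x) => [|c m q _ _ IHq]; first by rewrite !rmorph0.
rewrite !rmorphD /= IHq; congr (_ + _).
rewrite -mul_mpolyC mpolyXE_id !rmorphM !rmorph_prod /=; congr (_ * _).
  by rewrite -[c]intz rmorph_int !rmorph_int.
apply: eq_bigr => i _; rewrite !rmorphXn /=; congr (_ ^+ _).
by have := fv i; rewrite /hom_var inord_val.
Qed.

(* Hom^\times(G, H) in Hom(G, H), for G = (Z/pZ)^2 and H = mu_p x mu_p. *)
Definition KM_ideal (p : nat) : hom_ring p -> Prop :=
  times_ideal (over (hom_ring p) (ZpZp p)) (over (hom_ring p) (mumu p))
    (univ_hom p).
Arguments KM_ideal : clear implicits.

(* Hom^\times(H^\vee, G^\vee) in Hom(G, H), through phi |-> phi^\vee. *)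
Definition KM_dual_ideal (p : nat) : hom_ring p -> Prop :=
  times_ideal (cartier_dual (over (hom_ring p) (mumu p)))
    (cartier_dual (over (hom_ring p) (ZpZp p)))
    (dual_hom (univ_hom p)).
Arguments KM_dual_ideal : clear implicits.

Definition KMD_ideal (p : nat) : hom_ring p -> Prop :=
  sum_ideal (KM_ideal p) (KM_dual_ideal p).
Arguments KMD_ideal : clear implicits.

Definition Phi (R : comNzRingType) (p : nat) (x : R) : R :=
  \sum_(i < p) x ^+ i.

(* The point z of mu_p x mu_p is primitive when prim_eqn p z = 0. *)
Definition prim_eqn (R : comNzRingType) (p : nat) (z : R * R) : R :=
  Phi p z.1 * Phi p z.2.

(* a z + b w in mu_p x mu_p, written multiplicatively, for ab = (a, b). *)
Definition lin_comb (R : comNzRingType) (p : nat) (ab : 'F_p * 'F_p)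
    (z w : R * R) : R * R :=
  (z.1 ^+ ab.1 * w.1 ^+ ab.2, z.2 ^+ ab.1 * w.2 ^+ ab.2).

(* The elements whose vanishing expresses that z and w are linearly
   independent. *)
Definition lin_indep_eqns (R : comNzRingType) (p : nat) (z w : R * R) :
    R -> Prop :=
  fun r => exists2 ab : 'F_p * 'F_p,
    ab != (0, 0) & r = prim_eqn p (lin_comb ab z w).

Definition full_ideal (p : nat) : hom_ring p -> Prop :=
  gen_ideal (fun r =>
    lin_indep_eqns p (varS p, varT p) (varU p, varV p) r \/
    lin_indep_eqns p (varS p, varU p) (varT p, varV p) r).
Arguments full_ideal : clear implicits.

(* Main.v *)
From HB Require Import structures.
Require Import Defs.
From mathcomp Require Import all_boot.
From mathcomp Require Import all_algebra all_field.
From mathcomp Require Import ring boolp.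

(** Write h for the universal matrix (S, T; U, V).  The two sides of the
    equality match condition by condition: h is a times-homomorphism exactly
    where its rows are linearly independent ([KM_idealP]), and its Cartier
    dual, which is the transposed situation, is a times-homomorphism exactly
    where the columns are ([KM_dual_idealP]).  The ideal of an intersection is
    the sum of the ideals, so the theorem follows.

    Let x and y be the coordinates of mu_p x mu_p.  The times-condition
    compares two characteristic polynomials attached to a function f: that of
    multiplication by f on O(mu_p x mu_p), and the product of the X - f(P)
    over the p^2 values P of the homomorphism.  For a monomial f = x^a y^b
    other than 1, the first operator permutes the monomials without fixed
    point and has trace 0, while the sum of the values of f is
    Phi_p(S^a U^b) Phi_p(T^a V^b).  So the times-condition implies the
    independence of the rows.

    The converse has two parts.

    First, monomials.  Put s = S^a U^b and t = T^a V^b, with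
    Phi_p(s) Phi_p(t) = 0.  The values of x^a y^b are the s^i t^j, and
    [prod_double_powers] shows that the product of the 1 - c s^i t^j is
    (1 - c^p)^p.  This is an integrality statement: it is proved over
    Z[c][t][s], where one may divide by p ([prod_powers_generic],
    [prod_double_powers_generic]).  On the side of O(mu_p x mu_p) the same
    determinant is computed over the algebraic numbers by a Fourier transform
    on (Z/p)^2 ([det_shift_mx]).

    Second, arbitrary functions are reduced to monomials.  Knowing all traces
    would not be enough in small characteristic, but all determinants
    det(1 + c m) with m a monomial are enough ([det_determined_by_letters]):
    t-adically, 1 - t f can be multiplied by factors 1 + c m, with m a
    monomial and t dividing c, until it is congruent to 1 modulo any given
    power of t.  Since determinants are multiplicative, det(1 - t f) is then
    determined as a polynomial in t, and t can be set to 1. *)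

Set Implicit Arguments.
Unset Strict Implicit.
Unset Printing Implicit Defensive.

Import GRing.Theory Num.Theory.
Local Open Scope ring_scope.

(** * Congruences modulo an element *)

Definition cong (K : comNzRingType) (x u v : K) : Prop :=
  exists w, u = v + x * w.

Section Congruence.
Variables (K : comNzRingType) (x : K).
Implicit Types u v w : K.

Lemma cong_refl u : cong x u u.
Proof. by exists 0; rewrite mulr0 addr0. Qed.

Lemma cong_trans u v w : cong x u v -> cong x v w -> cong x u w.
Proof. by move=> [a ->] [b ->]; exists (b + a); rewrite mulrDr addrA. Qed.

Lemma cong_sym u v : cong x u v -> cong x v u.
Proof. by move=> [a ->]; exists (- a); rewrite mulrN addrK. Qed.

Lemma congM u v u' v' : cong x u v -> cong x u' v' -> cong x (u * u') (v * v').
Proof.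
by move=> [a ->] [b ->]; exists (a * v' + v * b + x * a * b); ring.
Qed.

Lemma congX u v n : cong x u v -> cong x (u ^+ n) (v ^+ n).
Proof.
move=> uv; elim: n => [|n IHn]; first exact: cong_refl.
by rewrite !exprS; apply: congM.
Qed.

Lemma cong_prod n (F G : 'I_n -> K) :
  (forall i, cong x (F i) (G i)) -> cong x (\prod_i F i) (\prod_i G i).
Proof. move=> FG; apply: (big_ind2 (cong x)) => //; [exact: cong_refl|exact: congM]. Qed.
End Congruence.

Lemma cong_1 (K : comNzRingType) (u v : K) : cong 1 u v.
Proof. by exists (u - v); rewrite mul1r addrC subrK. Qed.

(** * Products over powers of p-th roots of unity *)

Lemma Phi_rmorph (p : nat) (K L : comNzRingType) (f : {rmorphism K -> L}) z :
  f (Phi p z) = Phi p (f z).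
Proof. by rewrite rmorph_sum; apply: eq_bigr => i _; rewrite rmorphXn. Qed.

Lemma Phi_monic (p : nat) (K : comNzRingType) :
  (0 < p)%N -> Phi p ('X : {poly K}) \is monic.
Proof.
move=> p_gt0; have X1 := monicXsubC (1 : K).
by rewrite -(monicMl _ X1) polyC1 -subrX1 -polyC1 monicXnsubC.
Qed.

Lemma coef_comp_scaleX (K : comNzRingType) (q : {poly K}) (a : K) k :
  (q \Po (a *: 'X))`_k = a ^+ k * q`_k.
Proof.
rewrite coef_comp_poly.
under eq_bigr => i _ do rewrite exprZn coefZ coefXn.
have [k_lt|k_ge] := ltnP k (size q).
  rewrite (bigD1 (Ordinal k_lt)) //= eqxx mulr1 big1 ?addr0 1?mulrC // => i.
  by rewrite -val_eqE /= eq_sym => /negPf ->; rewrite !mulr0.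
rewrite (nth_default _ k_ge) mulr0 big1 // => i _.
have /negPf -> : k != i by rewrite neq_ltn (leq_trans (ltn_ord i) k_ge) orbT.
by rewrite !mulr0.
Qed.

(** Identities between polynomials with integer coefficients are carried to an
    arbitrary ring by iterating this extension of morphisms. *)
Lemma poly_lift (A K : comNzRingType) (f : {rmorphism A -> K}) (x : K) :
  exists g : {rmorphism {poly A} -> K},
    g 'X = x /\ forall a, g a%:P = f a.
Proof.
pose cx : commr_rmorph f x := fun a => mulrC x (f a).
exists (horner_morph cx).
by split=> [|a]; rewrite /= ?horner_morphX ?horner_morphC.
Qed.

Lemma prodr_const_ord (K : comNzRingType) n (x : K) : x ^+ n = \prod_(i < n) x.
Proof. by rewrite prodr_const card_ord. Qed.

Lemma cong_dvdp (A : idomainType) (q u v : {poly A}) :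
  q \is monic -> cong q u v <-> q %| u - v.
Proof.
move=> mq; split=> [[w ->]|].
  by rewrite addrC addKr dvdp_mulr.
move/(Pdiv.IdomainMonic.dvdpP mq) => [w e]; exists w.
by rewrite mulrC -e addrC subrK.
Qed.

Section PrimePhi.
Variables (p : nat).
Hypothesis hp : prime p.
Let p_gt0 := prime_gt0 hp.

(** The quotient by the monic polynomial Phi_p('X) has no p-torsion; this is
    where working with generic polynomials pays off. *)
Lemma dvdp_Phi_torsion (A : idomainType) (f : {poly A}) :
  p%:R != 0 :> A -> (Phi p 'X %| f *+ p) = (Phi p 'X %| f).
Proof. by move=> p_neq0; rewrite -scaler_nat dvdpZr. Qed.

Lemma dvdp_Phi_Xn (A : idomainType) n :
  (p %| n)%N -> Phi p 'X %| ('X^n - 1 : {poly A}).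
Proof.
move=> /dvdnP[m ->]; rewrite mulnC exprM subrX1 subrX1.
by rewrite -mulrA mulrCA dvdp_mulr.
Qed.

(** Modulo Phi_p, 'X^k - 1 divides 'X - 1 because k is invertible modulo p, and
    'X - 1 divides p = Phi_p(1).  So 'X^k - 1 divides p, which is not a zero
    divisor. *)
Lemma dvdp_Phi_cancel (A : idomainType) (f : {poly A}) k :
  p%:R != 0 :> A -> (0 < k < p)%N ->
  Phi p 'X %| ('X^k - 1) * f -> Phi p 'X %| f.
Proof.
move=> p_neq0 /andP[k_gt0 k_ltp] dvd_k.
have dvd_1 : Phi p 'X %| ('X - 1) * f.
  (* a is an inverse of k modulo p. *)
  have cop : coprime k p by rewrite coprime_sym prime_coprime // gtnNdvd.
  case: (egcdnP p k_gt0) => a b ab _.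
  have {}ab : (a * k = b * p + 1)%N by rewrite ab (eqP cop).
  have -> : ('X - 1) * f = ('X^(a * k) - 1) * f - 'X * f * ('X^(b * p) - 1).
    by rewrite ab exprD expr1; ring.
  rewrite dvdp_sub //; last by rewrite dvdp_mull // dvdp_Phi_Xn // dvdn_mull.
  by rewrite mulnC exprM subrX1 mulrAC dvdp_mulr.
have [g Phi_p] : cong ('X - 1) (Phi p 'X : {poly A}) (Phi p 1).
  apply: (big_ind2 (cong ('X - 1 : {poly A}))); first exact: cong_refl.
    by move=> ? ? ? ? [u ->] [v ->]; exists (u + v); ring.
  by move=> i _; rewrite expr1n; exists (\sum_(j < i) 'X ^+ j); rewrite -subrX1; ring.
rewrite -(dvdp_Phi_torsion _ p_neq0).
have -> : f *+ p = Phi p 'X * f - g * (('X - 1) * f).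
  rewrite Phi_p {1}/Phi; under eq_bigr => i _ do rewrite expr1n.
  by rewrite sumr_const card_ord -[f *+ p]mulr_natl; ring.
by apply: dvdp_sub; [rewrite dvdp_mulr | rewrite dvdp_mull].
Qed.

(** This is the factorization of 1 - 'X^p over the p-th roots of unity, for the
    generic root of Phi_p rather than a root in a field.  Replacing the outer
    variable Y by zY, where z is the inner one, permutes the factors up to
    z^p = 1, so the coefficient of Y^k is killed by z^k - 1 modulo Phi_p(z); it
    therefore vanishes for 0 < k < p.  The coefficient of Y^p follows by
    setting Y = 1. *)
Lemma prod_powers_generic : exists Q : {poly {poly int}},
  \prod_(i < p) (1 - ('X ^+ i)%:P * 'X) = 1 - 'X ^+ p + (Phi p 'X)%:P * Q.
Proof.
set F := \prod_(i < p) _.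
have p_neq0 : p%:R != 0 :> int by rewrite pnatr_eq0 -lt0n.
have F0 : F`_0 = 1.
  rewrite -horner_coef0 horner_prod big1 // => i _.
  by rewrite -polyC1 hornerD hornerN hornerM !hornerC hornerX mulr0 subr0.
have F1 : F.[1] = 0.
  rewrite horner_prod (bigD1 (Ordinal p_gt0)) //= expr0 polyC1 mul1r.
  by rewrite -polyC1 hornerD hornerN hornerX hornerC subrr mul0r.
have sizeF : (size F <= p.+1)%N.
  rewrite /F; elim: (p) => [|n IHn]; first by rewrite big_ord0 size_poly1.
  rewrite big_ord_recr /=; apply: (leq_trans (size_polyMleq _ _)).
  have : (size (1 - ('X ^+ n)%:P * 'X : {poly {poly int}})%R <= 2)%N.
    rewrite (leq_trans (size_polyD _ _)) // size_poly1 size_polyN geq_max /=.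
    rewrite (leq_trans (size_polyMleq _ _)) // size_polyX addn2 /=.
    by rewrite ltnS size_polyC_leq1.
  by move=> /(leq_add IHn); rewrite addn2 -subn1 leq_subLR add1n.
(* The left-hand side replaces the outer variable Y by zY. *)
have scaleF : (F \Po ('X *: 'X)) * (1 - 'X) = F * (1 - ('X ^+ p)%:P * 'X).
  have -> : F \Po ('X *: 'X) = \prod_(i < p) (1 - ('X ^+ i.+1)%:P * 'X).
    rewrite rmorph_prod; apply: eq_bigr => i _ /=.
    rewrite rmorphB rmorphM rmorph1 /= comp_polyC comp_polyX.
    by rewrite -mul_polyC mulrA -polyCM -exprSr.
  pose G i : {poly {poly int}} := 1 - ('X ^+ i)%:P * 'X.
  have : \prod_(i < p.+1) G i = G 0%N * \prod_(i < p) G i.+1 by rewrite big_ord_recl.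
  rewrite big_ord_recr /= => ->.
  have -> : G 0%N = 1 - 'X by rewrite /G expr0 polyC1 mul1r.
  by rewrite mulrC; congr (_ * _).
have dvdF k : Phi p 'X %| ('X^k - 1) * F`_k.
  elim: k => [|k IHk]; first by rewrite expr0 subrr mul0r dvdp0.
  have := congr1 (fun q : {poly {poly int}} => q`_k.+1) scaleF.
  rewrite !mulrBr !mulr1 !coefB mulrCA coefCM !coefMX !coef_comp_scaleX /= => e.
  have -> : ('X^(k.+1) - 1) * F`_k.+1 =
      ('X^k - 1) * F`_k - ('X^p - 1) * F`_k :> {poly int}.
    by rewrite mulrBl mul1r; rewrite (canRL (subrK _) e); ring.
  by rewrite dvdp_sub // dvdp_mulr // dvdp_Phi_Xn.
have dvdF' k : (0 < k < p)%N -> Phi p 'X %| F`_k.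
  by move=> hk; apply: dvdp_Phi_cancel (dvdF k).
have dvdFp : Phi p 'X %| F`_p + 1.
  have := F1; rewrite (horner_coef_wide _ sizeF).
  under eq_bigr => i _ do rewrite expr1n mulr1.
  rewrite big_ord_recr -[in \sum_(_ < p) _](prednK p_gt0) big_ord_recl /= F0.
  move=> e; have -> : F`_p + 1 = - \sum_(i < p.-1) F`_(bump 0 i).
    by apply/eqP; rewrite -addr_eq0; apply/eqP; rewrite -[RHS]e; ring.
  rewrite dvdpNr; apply: (big_ind (fun f => Phi p 'X %| f)) => [|u v|i _]; [exact: dvdp0|exact: dvdp_add|].
  by apply: dvdF'; rewrite /= /bump add1n -[X in (_ < X)%N]prednK // ltnS ltn_ord.
have dvd_all k : exists g : {poly int}, (F - (1 - 'X^p))`_k = Phi p 'X * g.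
  suff : Phi p 'X %| (F - (1 - 'X^p))`_k.
    move/(Pdiv.IdomainMonic.dvdpP (Phi_monic _ p_gt0)) => [g ->].
    by exists g; rewrite mulrC.
  rewrite !coefB coef1 coefXn.
  have [->|k_neq0] := eqVneq k 0%N.
    by rewrite F0 eq_sym (gtn_eqF p_gt0) subr0 subrr dvdp0.
  have [->|k_neqp] := eqVneq k p; first by rewrite sub0r opprK.
  rewrite subr0 subr0; have [k_ltp|] := ltnP k p.
    by apply: dvdF'; rewrite lt0n k_neq0.
  rewrite leq_eqVlt eq_sym (negPf k_neqp) /= => k_gtp.
  by rewrite nth_default ?dvdp0 // (leq_trans sizeF).
have [g gP] := fin_all_exists (fun k : 'I_p.+1 => dvd_all k).
exists (\sum_(k < p.+1) (g k)%:P * 'X^k).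
suff <- : F - (1 - 'X^p) = (Phi p 'X)%:P * \sum_(k < p.+1) (g k)%:P * 'X^k.
  by rewrite addrC subrK.
rewrite mulr_sumr; apply/polyP => k; rewrite coef_sum.
under eq_bigr => i _ do rewrite mulrA -polyCM -gP coefCM coefXn.
have [k_le|k_gt] := ltnP k p.+1.
  rewrite (bigD1 (Ordinal k_le)) //= eqxx mulr1 big1 ?addr0 // => i.
  by rewrite -val_eqE /= eq_sym => /negPf ->; rewrite mulr0.
rewrite big1 => [|i _].
  rewrite !coefB coef1 coefXn (nth_default _ (leq_trans sizeF k_gt)).
  by rewrite (gtn_eqF (leq_trans _ k_gt)) // (gtn_eqF k_gt) !subr0.
by rewrite (gtn_eqF (leq_trans (ltn_ord i) k_gt)) mulr0.
Qed.

Lemma prod_powers_cong (K : comNzRingType) (c s : K) :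
  cong (Phi p s) (\prod_(i < p) (1 - c * s ^+ i)) (1 - c ^+ p).
Proof.
have [Q QE] := prod_powers_generic.
have [e0 [e0X _]] := poly_lift (intmul (1 : K)) s.
have [e [eX eC]] := poly_lift e0 c.
exists (e Q).
have := congr1 e QE; rewrite rmorph_prod rmorphD rmorphB rmorphM /= eC.
rewrite rmorph1 rmorphXn /= eX Phi_rmorph e0X => <-.
apply: eq_bigr => i _.
by rewrite rmorphB rmorph1 rmorphM eC eX rmorphXn e0X mulrC.
Qed.

(** The first equality comes from [prod_powers_cong] applied to each c t^j, where
    the cofactor of Phi_p('X) is written as its value r at 1 plus a multiple of
    'X - 1; the latter will vanish once 'X^p = 1.  The second equality, the value
    of the first at 'X = 1, gives access to p r only. *)
Lemma prod_double_powers_lift (A : comNzRingType) (c t : A) :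
  exists (Q : {poly A}) (r : A),
    \prod_(j < p) \prod_(i < p) (1 - (c * t ^+ j)%:P * 'X ^+ i) =
      (\prod_(j < p) (1 - (c * t ^+ j) ^+ p))%:P
      + Phi p 'X * (('X - 1) * Q + r%:P)
    /\ (\prod_(j < p) (1 - c * t ^+ j)) ^+ p =
       \prod_(j < p) (1 - (c * t ^+ j) ^+ p) + r *+ p.
Proof.
have [q qE] : cong (Phi p ('X : {poly A}))
    (\prod_(j < p) \prod_(i < p) (1 - (c * t ^+ j)%:P * 'X ^+ i))
    (\prod_(j < p) (1 - (c * t ^+ j)%:P ^+ p)).
  by apply: cong_prod => j; apply: prod_powers_cong.
have prodC : \prod_(j < p) (1 - (c * t ^+ j)%:P ^+ p) =
             (\prod_(j < p) (1 - (c * t ^+ j) ^+ p))%:P.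
  rewrite rmorph_prod; apply: eq_bigr => j _.
  by rewrite rmorphB rmorph1 rmorphXn.
have /factor_theorem[Q QE] : root (q - (q.[1])%:P) 1.
  by rewrite /root hornerD hornerN hornerC subrr.
exists Q, q.[1]; split.
  rewrite qE prodC; congr (_ + _ * _).
  by rewrite mulrC -polyC1 -QE subrK.
have [e [eX eC]] := poly_lift idfun (1 : A).
have eq1 : e q = q.[1].
  rewrite -[q](subrK (q.[1])%:P) QE rmorphD rmorphM rmorphB /= eX !eC.
  by rewrite hornerD hornerM hornerXsubC !hornerC subrr !mulr0.
have := congr1 e qE; rewrite prodC rmorphD rmorphM rmorph_prod /=.
rewrite Phi_rmorph eX eC eq1 /=.
have -> : Phi p (1 : A) = p%:R.
  rewrite /Phi; under eq_bigr => i _ do rewrite expr1n.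
  by rewrite sumr_const card_ord.
rewrite mulr_natl => <-; rewrite -prodrXl; apply: eq_bigr => j _.
rewrite rmorph_prod [LHS]prodr_const_ord; apply: eq_bigr => i _.
by rewrite rmorphB rmorph1 rmorphM rmorphXn /= eX eC expr1n mulr1.
Qed.

(** Here t is an indeterminate.  Modulo Phi_p(t) both products in the formula for
    p r become (1 - c^p)^p, so Phi_p(t) divides p r, hence r. *)
Lemma prod_double_powers_generic (A : idomainType) (c : A) : p%:R != 0 :> A ->
  exists (Q : {poly {poly A}}) (r : {poly A}),
  \prod_(j < p) \prod_(i < p) (1 - (c%:P * 'X ^+ j)%:P * 'X ^+ i) =
  (\prod_(j < p) (1 - (c%:P * 'X ^+ j) ^+ p))%:P
   + Phi p 'X * (('X - 1) * Q + (Phi p 'X * r)%:P).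
Proof.
move=> p_neq0; have mPhi : Phi p ('X : {poly A}) \is monic by apply: Phi_monic.
have [Q [r [QE rE]]] := prod_double_powers_lift c%:P 'X.
suff [r' r'E] : cong (Phi p 'X) r 0 by exists Q, r'; rewrite QE r'E add0r.
apply/(cong_dvdp _ _ mPhi); rewrite subr0 -(dvdp_Phi_torsion _ p_neq0).
have -> : r *+ p = (\prod_(j < p) (1 - c%:P * 'X ^+ j)) ^+ p
                  - \prod_(j < p) (1 - (c%:P * 'X ^+ j) ^+ p).
  by rewrite rE addrC addKr.
apply/(cong_dvdp _ _ mPhi).
apply: (@cong_trans _ _ _ ((1 - c%:P ^+ p) ^+ p)).
  by apply: congX; apply: prod_powers_cong.
rewrite [(1 - _) ^+ p]prodr_const_ord.
apply: cong_prod => j; apply/(cong_dvdp _ _ mPhi).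
have -> : 1 - c%:P ^+ p - (1 - (c%:P * 'X ^+ j) ^+ p) =
          c%:P ^+ p * ('X^(j * p) - 1) :> {poly A}.
  by rewrite exprMn exprM; ring.
by rewrite dvdp_mull // dvdp_Phi_Xn // dvdn_mull.
Qed.

(** The hypothesis Phi_p(s) Phi_p(t) = 0 is weaker than the vanishing of one of
    the factors; it suffices because the error term of the generic identity is a
    multiple of s^p - 1 plus a multiple of this very product. *)
Lemma prod_double_powers (K : comNzRingType) (c s t : K) :
  s ^+ p = 1 -> t ^+ p = 1 -> Phi p s * Phi p t = 0 ->
  \prod_(j < p) \prod_(i < p) (1 - c * t ^+ j * s ^+ i) = (1 - c ^+ p) ^+ p.
Proof.
have p_neq0 : p%:R != 0 :> {poly int}.
  by rewrite -polyC_natr polyC_eq0 pnatr_eq0 -lt0n.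
move=> sp tp st0; have [Q [r QE]] := prod_double_powers_generic 'X p_neq0.
have [e0 [e0X _]] := poly_lift (intmul (1 : K)) c.
have [e1 [e1X e1C]] := poly_lift e0 t.
have [e [eX eC]] := poly_lift e1 s.
transitivity (e (\prod_(j < p) \prod_(i < p)
                   (1 - ('X%:P * 'X ^+ j)%:P * 'X ^+ i))).
  rewrite rmorph_prod; apply: eq_bigr => j _; rewrite rmorph_prod.
  apply: eq_bigr => i _.
  by rewrite rmorphB rmorph1 rmorphM rmorphXn /= eX eC rmorphM rmorphXn /= e1C e0X e1X.
rewrite QE rmorphD /= rmorphM [X in _ + _ * X]rmorphD rmorphM rmorphB /=.
rewrite rmorph1 Phi_rmorph eX !eC rmorphM /= Phi_rmorph e1X.
rewrite mulrDr !mulrA -[Phi p s * (s - 1)]mulrC -subrX1 sp subrr st0 !mul0r !addr0.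
rewrite rmorph_prod [RHS]prodr_const_ord; apply: eq_bigr => j _.
rewrite rmorphB rmorph1 rmorphXn rmorphM rmorphXn /= e1C e0X e1X.
by rewrite exprMn -exprM mulnC exprM tp expr1n mulr1.
Qed.
End PrimePhi.

(** * Determinants are determined by their values on monomials *)

Lemma det_1D (K : comNzRingType) n (x : K) (X : 'M[K]_n) :
  cong x (\det (1%:M + x *: X)) 1.
Proof.
pose X' : 'M[{poly K}]_n := map_mx polyC X.
pose P := \det (1%:M + 'X *: X').
have PE y : P.[y] = \det (1%:M + y *: X).
  rewrite -[LHS]/(horner_eval y P) -det_map_mx; congr (\det _).
  apply/matrixP => i j; rewrite !mxE rmorphD rmorphM /= /horner_eval hornerX.
  by rewrite hornerC -polyC_natr hornerC.
have /factor_theorem[q qE] : root (P - 1) 0.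
  by rewrite /root hornerD hornerN hornerC PE scale0r addr0 det1 subrr.
exists q.[x]; rewrite -PE -[P](subrK 1) qE polyC0 subr0.
by rewrite hornerD hornerC hornerMX addrC mulrC.
Qed.

(** An element congruent to 1 modulo t is invertible modulo every power of t. *)
Lemma cong_cancel (K : comNzRingType) (t u v w : K) N :
  cong t w 1 -> cong (t ^+ N) (u * w) (v * w) -> cong (t ^+ N) u v.
Proof.
move=> [z wE] [y E].
suff H k : (k <= N)%N -> cong (t ^+ k) u v by apply: H.
elim: k => [|k IHk] k_lt; first exact: cong_1.
have [a uE] := IHk (ltnW k_lt).
exists (t ^+ (N - k.+1) * y - a * z).
rewrite mulrBr mulrA -exprD subnKC // exprS.
apply: (addIr (u * (t * z))); transitivity (u * w); first by rewrite wE; ring.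
by rewrite E wE uE; ring.
Qed.

Section Elimination.
Variables (K : comNzRingType) (J : Type) (op : J -> J -> J) (n m : nat).
Variables (A : J -> 'M[K]_n) (B : J -> 'M[K]_m).
Hypothesis AM : forall j k, A (op j k) = A j *m A k.
Hypothesis BM : forall j k, B (op j k) = B j *m B k.

(** The same linear combination of the A j and of the B j, recorded jointly so
    that an elimination can run on both sides at once without naming its
    coefficients. *)
Inductive paired : 'M[K]_n -> 'M[K]_m -> Prop :=
| paired0 : paired 0 0
| pairedS c j X Y : paired X Y -> paired (c *: A j + X) (c *: B j + Y).

Lemma pairedD X Y X' Y' :
  paired X Y -> paired X' Y' -> paired (X + X') (Y + Y').
Proof.
move=> XY XY'; elim: XY => [|c j {}X {}Y _ IH]; first by rewrite !add0r.
by rewrite -!addrA; apply: pairedS.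
Qed.

Lemma pairedZ a X Y : paired X Y -> paired (a *: X) (a *: Y).
Proof.
elim=> [|c j {}X {}Y _ IH]; first by rewrite !scaler0; apply: paired0.
by rewrite !scalerDr !scalerA; apply: pairedS.
Qed.

Lemma pairedMr j X Y : paired X Y -> paired (X *m A j) (Y *m B j).
Proof.
elim=> [|c k {}X {}Y _ IH]; first by rewrite !mul0mx; apply: paired0.
by rewrite !mulmxDl -!scalemxAl -AM -BM; apply: pairedS.
Qed.

Hypothesis detAB : forall c j, \det (1%:M + c *: A j) = \det (1%:M + c *: B j).

Variable t : K.

(** Multiplying by 1 + t^e c C removes the term t^e c C; all the terms created
    have a factor t^(2e), hence t^(e+1). *)
Lemma elim_letter r (X Z C : 'M[K]_r) c e : (0 < e)%N ->
  (1%:M - (t ^+ e *: (c *: C + X) + t ^+ e.+1 *: Z)) *m (1%:M + (t ^+ e * c) *: C)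
  = 1%:M - (t ^+ e *: X + t ^+ e.+1 *:
      (Z + (t ^+ e.-1 * c) *: ((c *: C + X + t *: Z) *m C))).
Proof.
case: e => // e _; rewrite [e.+1.-1]/=.
rewrite mulmxDr mulmx1 -scalemxAr mulmxBl mul1mx !mulmxDl -!scalemxAl !mulmxDl -!scalemxAl.
move: (C *m C) (X *m C) (Z *m C) 1%:M => CC XC ZC I.
by apply/matrixP => i k; rewrite !mxE !exprS; ring.
Qed.

(** Induction on N - e: the terms of level e are eliminated one at a time with
    [elim_letter], each at the cost of a determinant det(1 + c A j) that is the
    same for B, and of further terms of level e + 1.  At level N nothing is left
    modulo t^N. *)
Lemma det_paired_level N d : forall e, (0 < e)%N -> (e + d = N)%N ->
  forall X X' Z Z', paired X X' -> paired Z Z' ->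
  cong (t ^+ N) (\det (1%:M - (t ^+ e *: X + t ^+ e.+1 *: Z)))
                (\det (1%:M - (t ^+ e *: X' + t ^+ e.+1 *: Z'))).
Proof.
elim: d => [|d IHd] e e_gt0 eN X X' Z Z' XX' ZZ'.
  have {}eN : e = N by rewrite -eN addn0.
  have H r (U V : 'M[K]_r) :
      cong (t ^+ N) (\det (1%:M - (t ^+ e *: U + t ^+ e.+1 *: V))) 1.
    have -> : t ^+ e *: U + t ^+ e.+1 *: V = t ^+ N *: (U + t *: V).
      by rewrite scalerDr scalerA -exprSr eN.
    by rewrite -scalerN; apply: det_1D.
  by apply: cong_trans (H _ _ _) (cong_sym (H _ _ _)).
elim: XX' Z Z' ZZ' => [|c j {}X {}X' XX' IH] Z Z' ZZ'.
  have := IHd e.+1 isT _ Z Z' 0 0 ZZ' paired0; rewrite !scaler0 !addr0 !add0r.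
  by apply; rewrite addSnnS.
apply: (@cong_cancel _ t _ _ (\det (1%:M + (t ^+ e * c) *: A j))).
  have -> : t ^+ e * c *: A j = t *: ((t ^+ e.-1 * c) *: A j).
    by rewrite scalerA mulrA -exprS prednK.
  exact: det_1D.
rewrite {2}detAB -!det_mulmx !elim_letter //; apply: IH.
apply: pairedD => //; apply: pairedZ; apply: pairedMr.
by apply: pairedD; [apply: pairedS | apply: pairedZ].
Qed.

Lemma det_paired X Y N : paired X Y ->
  cong (t ^+ N) (\det (1%:M - t *: X)) (\det (1%:M - t *: Y)).
Proof.
move=> XY; case: N => [|N].
  exact: cong_1.
have := @det_paired_level N.+1 N 1 isT (add1n N) _ _ _ _ XY paired0.
by rewrite !scaler0 !addr0 expr1.
Qed.
End Elimination.

(** The index set is a semigroup acting through A and B, so that the linear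
    combinations of the A j are closed under products.  Taking t = 'X in
    [det_paired] gives an equality of polynomials, which is then evaluated at 1:
    this removes the smallness assumption under which the elimination works. *)
Lemma det_determined_by_letters (L : comNzRingType) (J : finType)
    (op : J -> J -> J) n m (A : J -> 'M[L]_n) (B : J -> 'M[L]_m) :
  (forall j k, A (op j k) = A j *m A k) ->
  (forall j k, B (op j k) = B j *m B k) ->
  (forall (c : {poly L}) j, \det (1%:M + c *: map_mx polyC (A j)) =
                            \det (1%:M + c *: map_mx polyC (B j))) ->
  forall h : J -> L,
  \det (1%:M - \sum_j h j *: A j) = \det (1%:M - \sum_j h j *: B j).
Proof.
move=> AM BM detAB h.
pose A' j := map_mx polyC (A j); pose B' j := map_mx polyC (B j).
have XY : paired A' B' (\sum_j (h j)%:P *: A' j) (\sum_j (h j)%:P *: B' j).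
  apply: (big_ind2 (paired A' B')); first exact: paired0.
    by move=> *; apply: pairedD.
  by move=> j _; have := pairedS (h j)%:P j (paired0 A' B'); rewrite !addr0.
pose D r (C : J -> 'M[L]_r) :=
  \det (1%:M - 'X *: \sum_j (h j)%:P *: map_mx polyC (C j)).
have D1 r (C : J -> 'M[L]_r) : (D r C).[1] = \det (1%:M - \sum_j h j *: C j).
  rewrite -[LHS]/(horner_eval 1 _) /D -det_map_mx; congr (\det _).
  apply/matrixP => k l; rewrite !mxE !summxE rmorphB rmorphM rmorph_sum /=.
  rewrite {1 2}/horner_eval hornerX -polyC_natr hornerC mul1r; congr (_ - _).
  by apply: eq_bigr => j _; rewrite !mxE rmorphM /= /horner_eval !hornerC.
rewrite -!D1; congr (_.[1]); apply/polyP => k.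
have A'M j l : A' (op j l) = A' j *m A' l by rewrite /A' AM map_mxM.
have B'M j l : B' (op j l) = B' j *m B' l by rewrite /B' BM map_mxM.
have [w] := det_paired A'M B'M detAB 'X k.+1 XY; rewrite -/(D n A) -/(D m B) => ->.
by rewrite coefD mulrC coefMXn ltnSn addr0.
Qed.
(** * Translations and characters of (Z/p)^2 *)

(** Multiplication by the monomial of exponent j on R[x,y]/(x^p - 1, y^p - 1), in
    the monomial basis. *)
Definition shift_mx (K : comNzRingType) (p : nat) (j : 'Z_p * 'Z_p) :
    'M[K]_#|{: 'Z_p * 'Z_p}| :=
  \matrix_(k, l) (enum_val l == j + enum_val k)%:R.

Lemma big_enum_valT (G : finType) (R : Type) (idx : R) (op : Monoid.com_law idx)
    (F : G -> R) :
  \big[op/idx]_(i < #|G|) F (enum_val i) = \big[op/idx]_i F i.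
Proof. by rewrite [RHS](reindex _ (onW_bij _ (enum_val_bij G))). Qed.

Section Shift.
Variables (K : comNzRingType) (p : nat).
Implicit Types j k : 'Z_p * 'Z_p.

Lemma shift_mxD j k : shift_mx K (j + k) = shift_mx K j *m shift_mx K k.
Proof.
apply/matrixP => a b; rewrite !mxE -addrA addrCA.
rewrite -(sum_delta (j + enum_val a)
            (fun x => (enum_val b == k + x)%:R : K)) -big_enum_valT.
by apply: eq_bigr => i _; rewrite !mxE.
Qed.

Lemma shift_mx0 : shift_mx K (0 : 'Z_p * 'Z_p) = 1%:M.
Proof.
by apply/matrixP => a b; rewrite !mxE add0r (inj_eq enum_val_inj) eq_sym.
Qed.

Lemma map_shift_mx (L : comNzRingType) (f : {rmorphism K -> L}) j :
  map_mx f (shift_mx K j) = shift_mx L j.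
Proof. by apply/matrixP => a b; rewrite !mxE rmorph_nat. Qed.

Lemma mxtrace_shift j : j != 0 -> \tr (shift_mx K j) = 0.
Proof.
move=> /negPf j_neq0; apply: big1 => i _.
by rewrite !mxE -[X in X == _]add0r (inj_eq (addIr _)) eq_sym j_neq0.
Qed.
End Shift.

Section Pairing.
Variables (p : nat).
Hypothesis hp : prime p.
Let p_gt1 := prime_gt1 hp.
Local Notation G := ('Z_p * 'Z_p)%type.

Lemma big_Zp (R : Type) (idx : R) (op : Monoid.com_law idx) (F : nat -> R) :
  \big[op/idx]_(i : 'Z_p) F i = \big[op/idx]_(i < p) F i.
Proof.
suff eq_ord n : n = p -> \big[op/idx]_(i < n) F i = \big[op/idx]_(i < p) F i.
  exact: eq_ord (Zp_cast p_gt1).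
by move->.
Qed.

Lemma expZpD (K : comNzRingType) (z : K) (a b : 'Z_p) :
  z ^+ p = 1 -> z ^+ (a + b)%R = z ^+ a * z ^+ b.
Proof.
move=> zp; rewrite -exprD [in RHS](divn_eq (a + b) p) exprD mulnC exprM zp.
by rewrite expr1n mul1r /= [X in (_ %% X)%N]Zp_cast.
Qed.

Section Values.
Variables (K : comNzRingType) (s t u v : K).
Hypotheses (sp : s ^+ p = 1) (tp : t ^+ p = 1) (up : u ^+ p = 1) (vp : v ^+ p = 1).

(** The value at the point h(i) of the monomial of exponent j, for the matrix
    h = (s, t; u, v); it is bimultiplicative. *)
Definition pairing (j i : G) : K :=
  (s ^+ i.1 * t ^+ i.2) ^+ j.1 * (u ^+ i.1 * v ^+ i.2) ^+ j.2.

Lemma expr_p_prod (x y : K) (a b : nat) :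
  x ^+ p = 1 -> y ^+ p = 1 -> (x ^+ a * y ^+ b) ^+ p = 1.
Proof. by move=> xp yp; rewrite exprMn -!exprM !(mulnC _ p) !exprM xp yp !expr1n mulr1. Qed.

Lemma pairingD j k i : pairing (j + k) i = pairing j i * pairing k i.
Proof. by rewrite /pairing !expZpD ?expr_p_prod //; ring. Qed.

Lemma pairing0 i : pairing 0 i = 1.
Proof. by rewrite /pairing !expr0 mulr1. Qed.

(** Exchanging j and i amounts to transposing the matrix. *)
Lemma pairingE j i :
  pairing j i = (s ^+ j.1 * u ^+ j.2) ^+ i.1 * (t ^+ j.1 * v ^+ j.2) ^+ i.2.
Proof. by rewrite /pairing !exprMn -!exprM !(mulnC i.1) !(mulnC i.2); ring. Qed.

Lemma sum_pairing (j : G) :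
  \sum_i pairing j i = Phi p (s ^+ j.1 * u ^+ j.2) * Phi p (t ^+ j.1 * v ^+ j.2).
Proof.
under eq_bigr => i _ do rewrite pairingE.
rewrite -(pair_bigA _ (fun a b : 'Z_p => (s ^+ j.1 * u ^+ j.2) ^+ a *
                                         (t ^+ j.1 * v ^+ j.2) ^+ b)) /=.
rewrite /Phi -!(big_Zp _ (fun a => _ ^+ a)) mulr_suml; apply: eq_bigr => a _.
by rewrite mulr_sumr.
Qed.

Lemma prod_pairing (c : K) (j : G) :
  Phi p (s ^+ j.1 * u ^+ j.2) * Phi p (t ^+ j.1 * v ^+ j.2) = 0 ->
  \prod_i (1 + c * pairing j i) = (1 - (- c) ^+ p) ^+ p.
Proof.
move=> Phi0; under eq_bigr => i _ do rewrite pairingE.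
have := expr_p_prod j.1 j.2 sp up; have := expr_p_prod j.1 j.2 tp vp.
move: (s ^+ _ * _) (t ^+ _ * _) Phi0 => x y xy0 yp xp.
rewrite -(prod_double_powers hp (- c) yp xp); last by rewrite mulrC.
rewrite -(pair_bigA _ (fun a b : 'Z_p => 1 + c * (x ^+ a * y ^+ b))) /=.
rewrite -(big_Zp _ (fun a => \prod_(i < p) (1 - (- c) * x ^+ a * y ^+ i))).
apply: eq_bigr => a _.
rewrite -(big_Zp _ (fun b => 1 - (- c) * x ^+ a * y ^+ b)).
by apply: eq_bigr => b _; ring.
Qed.

Definition pairing_mx (j : G) : 'M[K]_#|{: G}| :=
  diag_mx (\row_i pairing j (enum_val i)).

Lemma pairing_mxD j k : pairing_mx (j + k) = pairing_mx j *m pairing_mx k.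
Proof.
rewrite mulmx_diag; congr diag_mx; apply/rowP => i.
by rewrite !mxE pairingD.
Qed.

Lemma det_pairing_mx c j :
  \det (1%:M + c *: pairing_mx j) = \prod_i (1 + c * pairing j i).
Proof.
rewrite -(big_enum_valT _ (fun i => 1 + c * pairing j i)).
have -> : 1%:M + c *: pairing_mx j =
          diag_mx (\row_i (1 + c * pairing j (enum_val i))).
  apply/matrixP => a b; rewrite !mxE.
  by case: eqP => _; rewrite ?mulr1n // !mulr0n mulr0 addr0.
by rewrite det_diag; apply: eq_bigr => i _; rewrite mxE.
Qed.

(** The columns of W are characters, hence common eigenvectors of all the
    translations. *)
Lemma shift_mx_eigen (j : G) (W : 'M[K]_#|{: G}|) :
  W = \matrix_(k, i) pairing (enum_val k) (enum_val i) ->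
  shift_mx K j *m W = W *m pairing_mx j.
Proof.
move=> ->; apply/matrixP => a b; rewrite mul_mx_diag !mxE mulrC -pairingD.
rewrite -(sum_delta (j + enum_val a) (fun x => pairing x (enum_val b))).
by rewrite -[RHS]big_enum_valT; apply: eq_bigr => i _; rewrite !mxE.
Qed.
End Values.

Lemma map_pairing_mx (K L : comNzRingType) (f : {rmorphism K -> L}) s t u v j :
  map_mx f (pairing_mx s t u v j) = pairing_mx (f s) (f t) (f u) (f v) j.
Proof.
apply/matrixP => a b; rewrite !mxE rmorphMn; congr (_ *+ _).
by rewrite /pairing !(rmorphM, rmorphXn).
Qed.
End Pairing.

(** * The times-condition on characteristic polynomials *)

Section TimesCondition.
Variables (p : nat).
Hypothesis hp : prime p.
Let p_gt0 := prime_gt0 hp.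
Let p_gt1 := prime_gt1 hp.
Local Notation G := ('Z_p * 'Z_p)%type.

Lemma Phi_prim_root (F : idomainType) (z : F) (k : 'Z_p) :
  p.-primitive_root z -> k != 0 -> Phi p (z ^+ k) = 0.
Proof.
move=> zP k_neq0; apply/eqP.
have : (z ^+ k - 1) * Phi p (z ^+ k) == 0.
  by rewrite -subrX1 -exprM mulnC exprM (prim_expr_order zP) expr1n subrr.
rewrite mulf_eq0 subr_eq0 -[1](expr0 z) (eq_prim_root_expr zP) mod0n.
rewrite modn_small; last by rewrite -[X in (_ < X)%N](Zp_cast p_gt1).
by rewrite -[0%N]/(val (0 : 'Z_p)) val_eqE (negPf k_neq0).
Qed.

Lemma Phi_pairing_prim_root (F : idomainType) (z : F) (j : G) :
  p.-primitive_root z -> j != 0 ->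
  Phi p (z ^+ j.1 * 1 ^+ j.2) * Phi p (1 ^+ j.1 * z ^+ j.2) = 0.
Proof.
case: j => a b zP; rewrite xpair_eqE negb_and !expr1n mulr1 mul1r /=.
by case/orP => h; rewrite (Phi_prim_root zP h) ?mul0r ?mulr0.
Qed.

(** Both sides are polynomials in c with integer coefficients, so the identity is
    checked over the algebraic numbers.  There, with a primitive root of unity z
    and the matrix (z, 1; 1, z), the matrix W of the pairing is the Fourier
    matrix of (Z/p)^2, which is invertible and diagonalizes the translations. *)
Lemma det_shift_mx (K : comNzRingType) (c : K) (j : G) : j != 0 ->
  \det (1%:M + c *: shift_mx K j) = (1 - (- c) ^+ p) ^+ p.
Proof.
move=> j_neq0.
suff univ : \det (1%:M + 'X *: shift_mx {poly int} j) = (1 - (- 'X) ^+ p) ^+ p.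
  have [e [eX _]] := poly_lift (intmul (1 : K)) c.
  have := congr1 e univ; rewrite -det_map_mx map_mxD map_mx1 map_mxZ map_shift_mx eX.
  by rewrite rmorphXn rmorphB !rmorph1 rmorphXn rmorphN /= eX.
have inj : injective (map_poly (intr : int -> algC)).
  exact: map_inj_poly intr_inj (rmorph0 _).
apply: inj.
rewrite -[LHS]det_map_mx map_mxD map_mx1 map_mxZ map_shift_mx.
rewrite rmorphXn rmorphB !rmorph1 rmorphXn rmorphN /= map_polyX.
have [z0 z0P] := C_prim_root_exists p_gt0.
pose L : idomainType := {poly algC}; pose z : L := z0%:P.
have zP : p.-primitive_root z by rewrite (fmorph_primitive_root polyC).
have zp := prim_expr_order zP; have p1 := expr1n L p.
rewrite -(prod_pairing hp zp p1 p1 zp _ (Phi_pairing_prim_root zP j_neq0)).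
rewrite -det_pairing_mx.
pose W : 'M[L]_#|{: G}| :=
  \matrix_(k, i) pairing z 1 1 z (enum_val k) (enum_val i).
pose V : 'M[L]_#|{: G}| :=
  \matrix_(i, k) pairing z 1 1 z (- (enum_val k : G) : G) (enum_val i : G).
(* Orthogonality of characters: V inverts W up to a power of p. *)
have WV : W *m V = (p%:R ^+ 2)%:M.
  apply/matrixP => k l; rewrite !mxE.
  pose d : G := enum_val k - enum_val l.
  transitivity (\sum_i pairing z 1 1 z d i).
    rewrite -[RHS]big_enum_valT; apply: eq_bigr => i _.
    by rewrite !mxE -pairingD.
  rewrite sum_pairing // /d; have [-> | k_neql] := eqVneq k l.
    rewrite subrr /= !expr0 mulr1 /Phi; under eq_bigr => i _ do rewrite expr1n.
    by rewrite sumr_const card_ord mulr1n expr2.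
  by rewrite Phi_pairing_prim_root // subr_eq0 (inj_eq enum_val_inj).
have detW : \det W != 0.
  apply/eqP => W0; have := congr1 determinant WV.
  rewrite det_mulmx W0 mul0r det_scalar => /eqP.
  by rewrite eq_sym !expf_eq0 -polyC_natr polyC_eq0 pnatr_eq0 (gtn_eqF p_gt0) !andbF.
apply: (mulIf detW); rewrite -det_mulmx [RHS]mulrC -det_mulmx; congr (\det _).
rewrite mulmxDl mulmxDr mul1mx mulmx1 -scalemxAl -scalemxAr.
by rewrite (shift_mx_eigen hp zp p1 p1 zp _ (erefl W)).
Qed.

Section Values.
Variables (K : comNzRingType) (s t u v : K).
Hypotheses (sp : s ^+ p = 1) (tp : t ^+ p = 1) (up : u ^+ p = 1) (vp : v ^+ p = 1).
(** Linear independence of the rows (s, t) and (u, v). *)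
Definition rows_indep : Prop := forall j : G, j != 0 ->
  Phi p (s ^+ j.1 * u ^+ j.2) * Phi p (t ^+ j.1 * v ^+ j.2) = 0.

Lemma det_shift_pairing (c : K) (j : G) : rows_indep ->
  \det (1%:M + c *: shift_mx K j) = \det (1%:M + c *: pairing_mx s t u v j).
Proof.
move=> indep; rewrite det_pairing_mx //.
have [->|j_neq0] := eqVneq j 0; last by rewrite det_shift_mx // prod_pairing // indep.
under eq_bigr => i _ do rewrite pairing0 mulr1.
rewrite shift_mx0 scalemx1 -raddfD det_scalar.
by rewrite prodr_const.
Qed.
End Values.

Lemma char_poly_pairing (K : comNzRingType) (s t u v : K) :
  s ^+ p = 1 -> t ^+ p = 1 -> u ^+ p = 1 -> v ^+ p = 1 ->
  rows_indep s t u v <->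
  forall f : G -> K, char_poly (\sum_j f j *: shift_mx K j) =
                     char_poly (\sum_j f j *: pairing_mx s t u v j).
Proof.
move=> sp tp up vp; split=> [indep f | eq_char j j_neq0]; last first.
  (* The monomial of exponent j has trace 0 on the left. *)
  have := eq_char (fun i => (i == j)%:R).
  have delta (A : G -> 'M[K]_#|{: G}|) : \sum_i (i == j)%:R *: A i = A j.
    rewrite (bigD1 j) //= eqxx scale1r big1 ?addr0 // => i /negPf ->.
    by rewrite scale0r.
  rewrite !delta => /(congr1 (fun q : {poly K} => q`_#|{: G}|.-1)).
  have card_gt0 : (0 < #|{: G}|)%N by apply/card_gt0P; exists 0.
  rewrite !char_poly_trace // mxtrace_shift // mxtrace_diag -sum_pairing //.
  rewrite oppr0 => /esym /eqP; rewrite oppr_eq0 => /eqP e.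
  rewrite -{}[RHS]e -[LHS]big_enum_valT; apply: eq_bigr => i _.
  by rewrite mxE.
pose L := {poly K}.
pose C (x : K) : L := x%:P; pose CC (x : L) : {poly L} := x%:P.
have CX (x : K) : x ^+ p = 1 -> C x ^+ p = 1 by move=> xp; rewrite -rmorphXn xp.
have CCX (x : L) : x ^+ p = 1 -> CC x ^+ p = 1 by move=> xp; rewrite -rmorphXn xp.
have indepCC : rows_indep (CC (C s)) (CC (C t)) (CC (C u)) (CC (C v)).
  move=> j j_neq0; have := congr1 CC (congr1 C (indep j j_neq0)).
  by rewrite /C /CC !rmorph0 !rmorphM /= !Phi_rmorph !rmorphM !rmorphXn.
(* 'X - f is written 1 - h, because the elimination concerns such elements. *)
pose h j := (if j == 0 then 1 - 'X else 0) + (f j)%:P.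
have hE (A : G -> 'M[K]_#|{: G}|) : A 0 = 1%:M ->
    char_poly (\sum_j f j *: A j) =
    \det (1%:M - \sum_j h j *: map_mx polyC (A j)).
  move=> A0; congr (\det _).
  under [in RHS]eq_bigr => j _ do rewrite scalerDl.
  rewrite big_split /= [X in _ - (X + _)](bigD1 (0 : G)) // eqxx A0 map_mx1.
  rewrite [X in _ - (_ + X + _)]big1 => [|i /negPf ->]; last by rewrite scale0r.
  rewrite addr0 /char_poly_mx map_mx_sum scalemx1 opprD addrA.
  congr (_ - _); first by rewrite -raddfB opprB addrC subrK.
  by apply: eq_bigr => j _; rewrite map_mxZ.
rewrite !hE; first last.
- exact: shift_mx0.
- apply/matrixP => a b; rewrite !mxE pairing0.
  by [].
apply: (det_determined_by_letters (op := fun j k : G => j + k)) => [j k|j k|c j].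
- by rewrite !map_shift_mx shift_mxD.
- by rewrite !map_pairing_mx pairing_mxD //; apply: CX.
- rewrite !map_shift_mx !map_pairing_mx; apply: det_shift_pairing => //;
  by apply: CCX; apply: CX.
Qed.
End TimesCondition.

(** * Ideals and the subfunctors they cut out *)

Lemma ideal_quotient (A : comNzRingType) (J : A -> Prop) :
  is_ideal J -> ~ J 1 ->
  exists (R : comNzRingType) (f : {rmorphism A -> R}), forall x, f x = 0 <-> J x.
Proof.
move=> [J0 JD JM] J1.
pose I : {pred A} := fun x => `[< J x >].
have I_ideal : idealr_closed I.
  split; first exact/asboolP.
    by apply/negP => /asboolP.
  by move=> a x y /asboolP Jx /asboolP Jy; apply/asboolP/JD => //; apply: JM.
pose IaM := GRing.isZmodClosed.Build _ I (idealr_closedB I_ideal).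
pose IpM := isProperIdeal.Build _ I (idealr_closed_nontrivial I_ideal).
pose Iid : idealr A := HB.pack I IaM IpM.
pose R : comNzRingType := {ideal_quot Iid}.
pose f : {rmorphism A -> R} := \pi_R%qT.
exists R, f => x; rewrite -(rmorph0 f).
split=> [/eqP|Jx]; last apply/eqP; rewrite -Quotient.idealrBE subr0.
  by move/asboolP.
exact/asboolP.
Qed.

Section Ideals.
Variables (A : comNzRingType).
Implicit Types J K : A -> Prop.

(** An ideal is recovered from the points at which it vanishes, by looking at the
    tautological point with values in its quotient ring. *)
Lemma times_ideal_gen (I I' : finType) (G : gscheme A I) (H : gscheme A I') M
    (X : A -> Prop) :
  (forall (R : comNzRingType) (f : {rmorphism A -> R}),
     times_hom (base_change f G) (base_change f H) (base_change_hom f M) <->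
     (forall x, X x -> f x = 0)) ->
  same_ideal (times_ideal G H M) (gen_ideal X).
Proof.
move=> timesX x; split=> [hx | hx R f /timesX fX]; last first.
  by apply: (hx (fun y => f y = 0)) => //; apply: ker_is_ideal.
have [X1|X1] := pselect (gen_ideal X 1).
  by have [_ _ JM] := gen_ideal_is_ideal X; rewrite -[x]mulr1; apply: JM.
have [R [f fE]] := ideal_quotient (gen_ideal_is_ideal X) X1.
apply/fE/hx/timesX => y Xy; apply/fE; exact: gen_ideal_sub.
Qed.

Lemma sum_ideal_gen J K (X Y : A -> Prop) :
  same_ideal J (gen_ideal X) -> same_ideal K (gen_ideal Y) ->
  same_ideal (sum_ideal J K) (gen_ideal (fun x => X x \/ Y x)).
Proof.
move=> JX KY x; split.
  move=> [y [z [/JX Jy /KY Kz ->]]].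
  have [_ D _] := gen_ideal_is_ideal (fun x => X x \/ Y x).
  by apply: D => I hI XYI; [apply: Jy | apply: Kz] => // w Hw; apply: XYI; [left|right].
apply.
  have [X0 XD XM] := gen_ideal_is_ideal X.
  have [Y0 YD YM] := gen_ideal_is_ideal Y.
  split.
  - by exists 0, 0; split; [exact/JX|exact/KY|rewrite addr0].
  - move=> _ _ [a [b [/JX Ja /KY Kb ->]]] [c [d [/JX Jc /KY Kd ->]]].
    exists (a + c), (b + d); split; [apply/JX; exact: XD|apply/KY; exact: YD|by rewrite addrACA].
  - move=> r _ [a [b [/JX Ja /KY Kb ->]]].
    exists (r * a), (r * b); split; [apply/JX; exact: XM|apply/KY; exact: YM|by rewrite mulrDr].
have [X0 _ _] := gen_ideal_is_ideal X; have [Y0 _ _] := gen_ideal_is_ideal Y.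
move=> y [Xy|Yy].
  by exists y, 0; split; [apply/JX; exact: gen_ideal_sub|exact/KY|rewrite addr0].
by exists 0, y; split; [exact/JX|apply/KY; exact: gen_ideal_sub|rewrite add0r].
Qed.
End Ideals.

(** * The times-condition for (Z/p)^2 and mu_p x mu_p *)

Section TimesHom.
Variables (p : nat).
Hypothesis hp : prime p.
Local Notation G := ('Z_p * 'Z_p)%type.

Lemma mult_mx_shift (K : comNzRingType) (H : gscheme K G) (f : G -> K) :
  (forall i j k, mulc H i j k = (k == i + j)%:R) ->
  mult_mx H f = \sum_j f j *: shift_mx K j.
Proof.
move=> HE; apply/matrixP => a b; rewrite !mxE summxE.
by apply: eq_bigr => j _; rewrite !mxE HE.
Qed.

Lemma mult_mx_diag (K : comNzRingType) (I : finType) (H : gscheme K I) (f : I -> K) :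
  (forall i j k, mulc H i j k = ((i == k) && (j == k))%:R) ->
  mult_mx H f = diag_mx (\row_i f (enum_val i)).
Proof.
move=> HE; apply/matrixP => a b; rewrite !mxE.
rewrite (bigD1 (enum_val b)) //= big1 => [|i /negPf ib]; last first.
  by rewrite HE ib mulr0.
rewrite HE eqxx (inj_eq enum_val_inj) addr0 mulr_natr.
by case: eqP => [->|].
Qed.

(** Independence of the rows persists under base change, so the comparison of
    characteristic polynomials over a single ring suffices. *)
Lemma times_hom_rows (K : comNzRingType) (H H' : gscheme K G) (M : G -> G -> K)
    (s t u v : K) :
  s ^+ p = 1 -> t ^+ p = 1 -> u ^+ p = 1 -> v ^+ p = 1 ->
  (forall i j k, mulc H i j k = ((i == k) && (j == k))%:R) ->
  (forall i j k, mulc H' i j k = (k == i + j)%:R) ->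
  (forall j i, M j i = pairing s t u v j i) ->
  times_hom H H' M <-> rows_indep p s t u v.
Proof.
move=> sp tp up vp HE H'E ME.
have step (R : comNzRingType) (g : {rmorphism K -> R}) (f : G -> R) :
    mult_mx (base_change g H') f = \sum_j f j *: shift_mx R j /\
    mult_mx (base_change g H) (pullback (base_change_hom g M) f) =
    \sum_j f j *: pairing_mx (g s) (g t) (g u) (g v) j.
  split; first by apply: mult_mx_shift => i j k; rewrite /= H'E rmorph_nat.
  rewrite mult_mx_diag => [|i j k]; last by rewrite /= HE rmorph_nat.
  apply/matrixP => a b; rewrite summxE !mxE -sumrMnl; apply: eq_bigr => j _.
  rewrite !mxE mulrnAr /base_change_hom ME; congr (_ * _ *+ _).
  by rewrite /pairing !(rmorphM, rmorphXn).
split=> [th | indep R g f].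
  apply/(char_poly_pairing hp sp tp up vp) => f.
  by have [<- <-] := step K idfun f; apply: th.
have [-> ->] := step R g f; move: f.
have gX x : x ^+ p = 1 -> g x ^+ p = 1 by move=> xp; rewrite -rmorphXn xp rmorph1.
apply/(char_poly_pairing hp); try exact: gX.
move=> j j_neq0; have := congr1 g (indep j j_neq0).
by rewrite rmorph0 !rmorphM /= !Phi_rmorph !rmorphM !rmorphXn.
Qed.
End TimesHom.

(** The exponents range over 'Z_p here and over 'F_p in [lin_indep_eqns]; these
    types are identified through [pdiv p = p]. *)
Lemma rows_indep_eqns (p : nat) (hp : prime p) (A K : comNzRingType)
    (f : {rmorphism A -> K}) (s t u v : A) :
  rows_indep p (f s) (f t) (f u) (f v) <->
  (forall x, lin_indep_eqns p (s, t) (u, v) x -> f x = 0).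
Proof.
have fE (a b : nat) : f (Phi p (s ^+ a * u ^+ b) * Phi p (t ^+ a * v ^+ b)) =
    Phi p (f s ^+ a * f u ^+ b) * Phi p (f t ^+ a * f v ^+ b).
  by rewrite rmorphM !Phi_rmorph !rmorphM !rmorphXn.
rewrite /lin_indep_eqns /prim_eqn /lin_comb (pdiv_id hp) /=.
split=> [indep x [ab ab_neq0 ->] | eqns j j_neq0]; first by rewrite fE indep.
by rewrite -fE; apply: eqns; exists j.
Qed.

(** Destructing p makes the index types 'I_p and 'Z_p convertible. *)
Lemma KM_idealP (p : nat) : prime p ->
  same_ideal (@KM_ideal p)
    (gen_ideal (lin_indep_eqns p (varS p, varT p) (varU p, varV p))).
Proof.
case: p => [|[|q]] // hp; apply: times_ideal_gen => R f.
have fX k : f (hom_var q.+2 k) ^+ q.+2 = 1 by rewrite -rmorphXn hom_varXp rmorph1.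
rewrite -(rows_indep_eqns hp).
apply: (times_hom_rows hp (fX 0%N) (fX 1%N) (fX 2%N) (fX 3%N)) => [i j k|i j k|j i].
- by rewrite /= [X in f X](ZpZp_mulc (hom_ring q.+2) i j k) rmorph_nat.
- rewrite [mulc _ _ _ _]/= [X in f X](@mumu_mulc q.+2 (hom_ring q.+2) isT i j k) rmorph_nat.
  congr (nat_of_bool (_ == _))%:R; congr (_, _); exact: val_inj.
- by rewrite /base_change_hom /univ_hom /pairing !(rmorphM, rmorphXn).
Qed.

(** Cartier duality exchanges the roles of the monomials and of the points, which
    transposes the matrix: T and U are swapped. *)
Lemma KM_dual_idealP (p : nat) : prime p ->
  same_ideal (@KM_dual_ideal p)
    (gen_ideal (lin_indep_eqns p (varS p, varU p) (varT p, varV p))).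
Proof.
case: p => [|[|q]] // hp; apply: times_ideal_gen => R f.
have fX k : f (hom_var q.+2 k) ^+ q.+2 = 1 by rewrite -rmorphXn hom_varXp rmorph1.
rewrite -(rows_indep_eqns hp).
apply: (times_hom_rows hp (fX 0%N) (fX 2%N) (fX 1%N) (fX 3%N)) => [i j k|i j k|j i].
- by rewrite /= [X in f X](@mumu_comulc q.+2 (hom_ring q.+2) i j k) rmorph_nat.
- by rewrite /= [X in f X](ZpZp_comulc (hom_ring q.+2) i j k) rmorph_nat.
- rewrite pairingE.
  by rewrite /base_change_hom /dual_hom /univ_hom !(rmorphM, rmorphXn).
Qed.

Theorem theorem1p2 (p : nat) (hp : prime p) :
  same_ideal (KMD_ideal p) (full_ideal p).
Proof. exact: sum_ideal_gen (KM_idealP hp) (KM_dual_idealP hp). Qed.
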